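(* $\mathrm{cf}^\ast(\mathrm{Sym}(\omega))\geq\mathrm{cov}(\mathfrak D_{\mathit{fin}})$. Moreover, NCF implies that $\mathrm{cf}^\ast(\mathrm{Sym}(\omega))=\mathfrak d$.
   Context: For $x,y\in\omega^\omega$, $x\leq^\ast y$ means $x(n)\leq y(n)$ for all but finitely many $n$; $\mathfrak d$ is the dominating number (the minimal size of a $\leq^\ast$-cofinal subset of $\omega^\omega$). $\omega^{\uparrow\omega}$ is the set of all unbounded nondecreasing elements of $\omega^\omega$. A set $F\subset\omega^{\uparrow\omega}$ is finitely dominating if for every $x\in\omega^\omega$ there is a finite subset $\{f_0,\ldots,f_n\}$ of $F$ with $x\leq^\ast\max\{f_0,\ldots,f_n\}$ (pointwise maximum). $\mathrm{cov}(\mathfrak D_{\mathit{fin}})$ is the minimal size of a family of non-finitely dominating subsets of $\omega^{\uparrow\omega}$ covering $\omega^{\uparrow\omega}$. $\mathrm{Sym}(\omega)$ is the group of all permutations of $\omega$. For an increasing function $f\in\omega^\omega$, $S_f$ is the subgroup of $\mathrm{Sym}(\omega)$ generated by $\{\pi\in\mathrm{Sym}(\omega):\pi,\pi^{-1}\leq^\ast f\}$. $\mathrm{cf}^\ast(\mathrm{Sym}(\omega))$ is the minimal length $\lambda$ of an increasing (with respect to inclusion) chain $\langle G_i:i<\lambda\rangle$ of proper subgroups of $\mathrm{Sym}(\omega)$ with $\bigcup_{i<\lambda}G_i=\mathrm{Sym}(\omega)$ such that for every increasing $f\in\omega^\omega$ there is $i<\lambda$ with $S_f\subset G_i$. All filters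 are assumed non-principal. Ultrafilters $\mathcal F$ and $\mathcal U$ on $\omega$ are coherent if there is an increasing sequence $\langle k_n:n\in\omega\rangle$ of natural numbers such that for every $I\subset\omega$, $\bigcup_{n\in I}[k_n,k_{n+1})\in\mathcal F$ if and only if $\bigcup_{n\in I}[k_n,k_{n+1})\in\mathcal U$. NCF is the statement that all (non-principal) ultrafilters on $\omega$ are coherent to each other. *)

(* Defs.v *)
From HB Require Import structures.
From mathcomp Require Import all_boot all_order.
From mathcomp Require Import all_classical.
From mathcomp Require wochoice.

Set Implicit Arguments.
Unset Strict Implicit.
Unset Printing Implicit Defensive.

Local Open Scope classical_set_scope.

(* Ordinals are represented by well-ordered types. They are compared through
   initial embeddings, and equality of ordinals is order isomorphism. *)
Record woType := WoType {
  wo_sort :> Type;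
  wo_le : rel wo_sort;
  wo_leP : wochoice.well_order wo_le }.
Arguments wo_le {_}.

Definition ord_le (a b : woType) : Prop :=
  exists f : a -> b, {mono f : x y / wo_le x y} /\
    forall x z, wo_le z (f x) -> exists y, f y = z.

Definition ord_eq (a b : woType) : Prop :=
  exists f : a -> b, {mono f : x y / wo_le x y} /\ bijective f.

Lemma wo_void : wochoice.well_order (fun _ _ : void => true).
Proof. by move=> A [[]]. Qed.

Definition ord_zero : woType := WoType wo_void.

Definition is_least_ord (P : woType -> Prop) (a : woType) : Prop :=
  P a /\ forall b, P b -> ord_le a b.

(* The least ordinal satisfying P; it is determined up to ord_eq. The default
   value ord_zero is only taken when no ordinal satisfies P. *)
Definition least_ord (P : woType -> Prop) : woType :=
  if pselect (exists a, is_least_ord P a) is left e then projT1 (cid e)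
  else ord_zero.

(* The minimal cardinality of a set F satisfying P. As usual, a cardinal is
   the least ordinal of that cardinality. *)
Definition min_card {T : Type} (P : set T -> Prop) : woType :=
  least_ord (fun k => exists F : set T, P F /\ ([set: k] #= F)%card).

Definition le_star (x y : nat -> nat) : Prop :=
  finite_set [set n | ~ (x n <= y n)%N].

Definition dominating (D : set (nat -> nat)) : Prop :=
  forall x, exists2 y, D y & le_star x y.

Definition dominating_number : woType := min_card dominating.

Definition unbounded_nondecreasing : set (nat -> nat) :=
  [set f | {homo f : m n / (m <= n)%N} /\ forall b, exists n, (b < f n)%N].

Definition finitely_dominating (F : set (nat -> nat)) : Prop :=
  forall x : nat -> nat, exists (n : nat) (f : 'I_n.+1 -> nat -> nat),
    (forall i, F (f i)) /\ le_star x (fun k => \max_(i < n.+1) f i k).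

Definition cov_Dfin : woType :=
  min_card (fun C : set (set (nat -> nat)) =>
    (forall A, C A ->
       A `<=` unbounded_nondecreasing /\ ~ finitely_dominating A) /\
    \bigcup_(A in C) A = unbounded_nondecreasing).

(* The permutations of nat; two of them with the same underlying function are
   equal (sym_ext). *)
Record sym := Sym {
  sym_fun :> nat -> nat;
  sym_inv : nat -> nat;
  sym_funK : cancel sym_fun sym_inv;
  sym_invK : cancel sym_inv sym_fun }.

Lemma sym_ext (p q : sym) : sym_fun p =1 sym_fun q -> p = q.
Proof.
case: p q => [f g fK gK] [f' g' fK' gK'] /= /funext ff'.
have gg' : g = g' by apply: funext => x; rewrite -{1}[x]gK' -ff' fK.
by move: fK gK fK' gK'; rewrite ff' gg' => *; congr Sym; exact: Prop_irrelevance.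
Qed.

HB.instance Definition _ := gen_eqMixin sym.
HB.instance Definition _ := gen_choiceMixin sym.

Definition sym_one : sym := @Sym id id (frefl _) (frefl _).

Definition sym_inverse (p : sym) : sym := Sym (sym_invK p) (sym_funK p).

Definition sym_mul (p q : sym) : sym :=
  Sym (can_comp (sym_funK p) (sym_funK q)) (can_comp (sym_invK q) (sym_invK p)).

Lemma sym_mulA : associative sym_mul.
Proof. by move=> p q r; exact: sym_ext. Qed.
Lemma sym_mul1 : left_id sym_one sym_mul.
Proof. by move=> p; exact: sym_ext. Qed.
Lemma sym_mulr1 : right_id sym_one sym_mul.
Proof. by move=> p; exact: sym_ext. Qed.
Lemma sym_mulV : left_inverse sym_one sym_inverse sym_mul.
Proof. by move=> p; apply: sym_ext => x; exact: sym_funK. Qed.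
Lemma sym_mulrV : right_inverse sym_one sym_inverse sym_mul.
Proof. by move=> p; apply: sym_ext => x; exact: sym_invK. Qed.

HB.instance Definition _ :=
  isGroup.Build sym sym_mulA sym_mul1 sym_mulr1 sym_mulV sym_mulrV.

Definition subgroup (G : set sym) : Prop := group_closed (mem G).

Definition increasing (f : nat -> nat) : Prop := {homo f : m n / (m < n)%N}.

Definition S_gen (f : nat -> nat) : set sym :=
  smallest subgroup [set p : sym | le_star p f /\ le_star (p^-1)%g f].

(* Increasing chains are not required to be strictly increasing; this does not
   change their minimal length. *)
Definition cf_star_chain (l : woType) (G : l -> set sym) : Prop :=
  [/\ forall i, subgroup (G i) /\ G i <> setT,
      {homo G : i j / wo_le i j >-> i `<=` j},
      \bigcup_i G i = setT &
      forall f, increasing f -> exists i, S_gen f `<=` G i].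

Definition cf_star_Sym : woType :=
  least_ord (fun l => exists G : l -> set sym, cf_star_chain G).

Definition nonprincipal {T : Type} (F : set_system T) : Prop :=
  forall A, F <> globally A.

Definition coherent (F U : set_system nat) : Prop :=
  exists2 k : nat -> nat, increasing k &
    forall I : set nat,
      F (\bigcup_(n in I) [set m | (k n <= m < k n.+1)%N]) <->
      U (\bigcup_(n in I) [set m | (k n <= m < k n.+1)%N]).

Definition NCF : Prop :=
  forall F U : set_system nat, UltraFilter F -> UltraFilter U ->
    nonprincipal F -> nonprincipal U -> coherent F U.

(* Main.v *)
Require Import Defs.
From mathcomp Require Import all_boot all_order.
From mathcomp Require Import all_classical.
From mathcomp Require wochoice.
From mathcomp Require Import zify.

(** The first inequality. Let G_i, for i < lambda, be a chain as in the
    definition of cf*(Sym(omega)), and let F_i be the set of the unbounded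
    nondecreasing f such that G_i contains S_(f + id). The F_i cover the
    unbounded nondecreasing functions, and none is finitely dominating.
    Indeed, if an involution s is bounded by the maximum of finitely many f_j
    in F_i, then all but finitely many transposed pairs x < s x satisfy s x <=
    f_j x for some j, so s is a product of commuting involutions, the j-th one
    in S_(f_j + id) ([involution_in_subgroup]). Thus a finitely dominating F_i
    would put all involutions in G_i, hence all permutations, as each
    permutation is a product of two involutions ([sym_two_involutions]).

    The bound cf*(Sym(omega)) <= d needs no hypothesis. Given a dominating
    family indexed by the ordinal d, the subgroups generated by the
    permutations bounded by members of an initial part of the family form a
    chain ([dominated_subgroup_chain]). They are proper because their elements
    are bounded by fewer than d functions, whereas permutations are not: some
    permutation sends each 2 * i to 2 * h i + 1, for any given injective h.
    This bound also shows that chains exist.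

    It remains to see that NCF implies d <= cov(D_fin). First, NCF yields a
    free ultrafilter W with a base of fewer than d sets ([NCF_small_ultra]):
    otherwise any filter generated by fewer than d sets can be extended so as
    to avoid coherence with a given ultrafilter V through a given interval
    partition ([sfip_extend]), and d such steps produce an ultrafilter that is
    not coherent with V ([noncoherent_ultra]). Second, a set F that is not
    finitely dominating is bounded by a single function modulo some free
    ultrafilter ([not_finitely_dominating_bound]). Since this ultrafilter is
    coherent with W, F is dominated by a family indexed by the base of W
    ([base_bound]). So fewer than d sets covering the unbounded nondecreasing
    functions, none of them finitely dominating, would give a dominating
    family of fewer than d functions.

    Fewer than d is expressed by [small]. The stability of this notion under
    products and finite sequences rests on the fact that an infinite set has
    as many finite sequences as elements ([seq_inj]). *)

Set Implicit Arguments.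
Unset Strict Implicit.
Unset Printing Implicit Defensive.

Local Open Scope classical_set_scope.

(** * Comparison of well-orders *)

Lemma wo_min (a : woType) (P : set a) (x : a) : P x ->
  exists2 m, P m & forall y, P y -> wo_le m y.
Proof.
move=> Px; have [|m [[/asboolP mP mmin] _]] := @wo_leP a [pred y | `[< P y >]].
  by exists x; apply/asboolP.
by exists m => // y Py; apply: mmin; apply/asboolP.
Qed.

Lemma wo_refl (a : woType) : reflexive (@wo_le a).
Proof. by move=> x; have [m -> ] := @wo_min a (eq^~ x) x erefl; apply. Qed.

Lemma wo_anti (a : woType) (x y : a) : wo_le x y -> wo_le y x -> x = y.
Proof.
move=> xy yx; have [|m [_ mU]] := @wo_leP a [pred z | `[< z = x \/ z = y >]].
  by exists x; apply/asboolP; left.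
have hx : m = x.
  by apply: mU; split; [apply/asboolP; left|move=> z /asboolP[] ->;
    rewrite ?wo_refl].
have hy : m = y.
  by apply: mU; split; [apply/asboolP; right|move=> z /asboolP[] ->;
    rewrite ?wo_refl].
by rewrite -hx.
Qed.

Lemma wo_total (a : woType) : total (@wo_le a).
Proof.
move=> x y; have [m [] -> mmin] := @wo_min a [set z | z = x \/ z = y] x
  (or_introl erefl).
  by rewrite mmin //; right.
by apply/orP; right; apply: mmin; left.
Qed.

Lemma wo_trans (a : woType) : transitive (@wo_le a).
Proof.
move=> y x z xy yz.
have [|m mP mmin] := @wo_min a [set u | [\/ u = x, u = y | u = z]] x.
  by constructor 1.
have mx : wo_le m x by apply: mmin; constructor 1.
have my : wo_le m y by apply: mmin; constructor 2.
have mz : wo_le m z by apply: mmin; constructor 3.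
case: mP mx my mz => -> // mx my mz.
  by rewrite (wo_anti xy mx).
by rewrite -(wo_anti yz my).
Qed.

Lemma wo_ltW (a : woType) (x y : a) : ~~ wo_le x y -> wo_le y x.
Proof. by have /orP[->|] := wo_total x y. Qed.

Lemma wo_lt_le_trans (a : woType) (x y z : a) :
  ~~ wo_le y x -> wo_le y z -> ~~ wo_le z x.
Proof. by move=> yx yz; apply: contra yx => /(wo_trans yz). Qed.

Lemma wo_le_lt_trans (a : woType) (x y z : a) :
  wo_le x y -> ~~ wo_le z y -> ~~ wo_le z x.
Proof. by move=> xy zy; apply: contra zy => zx; exact: wo_trans zx xy. Qed.

Lemma wo_ind (a : woType) (P : a -> Prop) :
  (forall x, (forall y, ~~ wo_le x y -> P y) -> P x) -> forall x, P x.
Proof.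
move=> ih x; apply: contrapT => nPx.
have [m nPm mmin] := @wo_min a [set z | ~ P z] x nPx.
apply: nPm; apply: ih => y my; apply: contrapT => nPy.
by move: my; rewrite (mmin _ nPy).
Qed.

Lemma wo_sub_subproof (a : woType) (P : set a) :
  wochoice.well_order (fun u v : {x : a | P x} => wo_le (sval u) (sval v)).
Proof.
move=> A [[x Px] Ax].
have [|m [Pm Am] mmin] :=
    @wo_min a [set y | exists Py : P y, exist P y Py \in A] x;
      first by exists Px.
have mA : wochoice.minimum_of
    (fun u v : {x : a | P x} => wo_le (sval u) (sval v)) A (exist P m Pm).
  by split=> // -[y Py] Ay; apply: mmin; exists Py.
exists (exist P m Pm); split=> // -[y Py] [Ay ymin].
have e : m = y.
  by apply: wo_anti; [exact: (mA.2 _ Ay) | exact: (ymin _ Am)].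
by subst y; rewrite (Prop_irrelevance Py Pm).
Qed.

(** The well-order induced on a subset. *)
Definition wo_sub (a : woType) (P : set a) : woType :=
  WoType (@wo_sub_subproof a P).

(** The initial segment of the elements strictly below x. *)
Definition wo_seg (a : woType) (x : a) : woType :=
  wo_sub [set y : a | ~~ wo_le x y].

Lemma ord_le_trans (a b c : woType) : ord_le a b -> ord_le b c -> ord_le a c.
Proof.
move=> [f [fm fi]] [g [gm gi]]; exists (g \o f); split.
  by move=> x y /=; rewrite gm fm.
move=> x z /= gz; have [y yz] := gi _ _ gz.
by move: gz; rewrite -yz gm => /fi[t <-]; exists t.
Qed.

Lemma ord_eq_le (a b : woType) : ord_eq a b -> ord_le a b.
Proof.
by move=> [f [fm [g _ gK]]]; exists f; split=> // x z _; exists (g z).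
Qed.

Lemma ord_eq_sym (a b : woType) : ord_eq a b -> ord_eq b a.
Proof.
move=> [f [fm [g fK gK]]]; exists g; split; last by exists f.
by move=> x y; rewrite -fm !gK.
Qed.

Lemma ord_eq_trans (a b c : woType) : ord_eq a b -> ord_eq b c -> ord_eq a c.
Proof.
move=> [f [fm fb]] [g [gm gb]]; exists (g \o f); split; last exact: bij_comp.
by move=> x y /=; rewrite gm fm.
Qed.

Lemma wo_mono_inj (a b : woType) (f : a -> b) :
  {mono f : x y / wo_le x y} -> injective f.
Proof. by move=> fm x y e; apply: wo_anti; rewrite -fm e wo_refl. Qed.

Lemma ord_eq_bij (a b : woType) (f : a -> b) : {mono f : x y / wo_le x y} ->
  (forall y, exists x, f x = y) -> ord_eq a b.
Proof.
move=> fm /choice[g gK]; exists f; split=> //; exists g => // x.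
by apply: (wo_mono_inj fm); rewrite gK.
Qed.

(** Two well-orders are comparable: a maximal isomorphism between initial
    segments exhausts one of them. *)
Lemma ord_comparable (a b : woType) :
  ord_le a b \/ exists x : a, ord_eq (wo_seg x) b.
Proof.
pose Q (R : set (a * b)) :=
  [/\ forall u v, R u -> R v -> wo_le u.1 v.1 = wo_le u.2 v.2,
      forall u x, R u -> wo_le x u.1 -> exists y, R (x, y) &
      forall u y, R u -> wo_le y u.2 -> exists x, R (x, y)].
have [F FQ Ftot|R [[Rm R1 R2] Rmax]] := @Zorn_bigcup _ Q.
  split.
  - move=> u v [A FA Au] [B FB Bv]; have [AB|BA] := Ftot _ _ FA FB.
      by have [m _ _] := FQ _ FB; apply: m => //; exact: AB.
    by have [m _ _] := FQ _ FA; apply: m => //; exact: BA.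
  - move=> u x [A FA Au] xu; have [_ i _] := FQ _ FA.
    by have [y Ay] := i u x Au xu; exists y, A.
  - move=> u y [A FA Au] yu; have [_ _ i] := FQ _ FA.
    by have [x Ax] := i u y Au yu; exists x, A.
have [dom|] := pselect (forall x, exists y, R (x, y)).
  left; have [f fR] := choice dom; exists f; split.
    by move=> x y; rewrite -(Rm _ _ (fR x) (fR y)).
  move=> x z zfx; have [y Ryz] := R2 _ _ (fR x) zfx; exists y.
  by apply: wo_anti; [rewrite -(Rm _ _ (fR y) Ryz)|rewrite -(Rm _ _ Ryz (fR
    y))];
     rewrite wo_refl.
move=> /existsNP[x0 nx0].
have [x nx xmin] := @wo_min a [set x | ~ exists y, R (x, y)] x0 nx0.
have {x0 nx0} lx x' y' : R (x', y') -> ~~ wo_le x x'.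
  by move=> R'; apply/negP => /(R1 _ _ R').
have lx' x' : ~~ wo_le x x' -> exists y, R (x', y).
  by move=> l; apply: contrapT => /xmin; apply/negP.
have [ran|] := pselect (forall y, exists x, R (x, y)).
  right; exists x; apply: ord_eq_sym; have [g gR] := choice ran.
  apply: (@ord_eq_bij _ (wo_seg x) (fun y => exist _ (g y) (lx _ _ (gR y)))).
    by move=> y z /=; rewrite (Rm _ _ (gR y) (gR z)).
  move=> [x' x'x]; have [y Ry] := lx' _ x'x; exists y.
  have e : g y = x'.
    by apply: wo_anti; [rewrite (Rm _ _ (gR y) Ry)|rewrite (Rm _ _ Ry (gR y))];
       rewrite wo_refl.
  by subst x'; congr exist; exact: Prop_irrelevance.
move=> /existsNP[y0 ny0].
have [y ny ymin] := @wo_min b [set y | ~ exists x, R (x, y)] y0 ny0.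
have {y0 ny0} ly x' y' : R (x', y') -> ~~ wo_le y y'.
  by move=> R'; apply/negP => /(R2 _ _ R').
have ly' y' : ~~ wo_le y y' -> exists x, R (x, y').
  by move=> l; apply: contrapT => /ymin; apply/negP.
exfalso; apply: (Rmax (R `|` [set (x, y)])).
  split; first by move=> ?; left.
  by move=> h; apply: nx; exists y; apply: h; right.
split.
- move=> [x1 y1] [x2 y2] [R1'|[-> ->]] [R2'|[-> ->]] /=.
  + exact: (Rm _ _ R1' R2').
  + by rewrite (wo_ltW (lx _ _ R1')) (wo_ltW (ly _ _ R1')).
  + by rewrite (negbTE (lx _ _ R2')) (negbTE (ly _ _ R2')).
  + by rewrite !wo_refl.
- move=> [x1 y1] x' [R'|[-> _]] /= l.
    by have [z] := R1 _ _ R' l; exists z; left.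
  have [e|/lx'[z]] := boolP (wo_le x x'); last by exists z; left.
  by rewrite (wo_anti l e); exists y; right.
- move=> [x1 y1] x' [R'|[_ ->]] /= l.
    by have [z] := R2 _ _ R' l; exists z; left.
  have [e|/ly'[z]] := boolP (wo_le y x'); last by exists z; left.
  by rewrite (wo_anti l e); exists x; right.
Qed.

Lemma wo_seg_seg (a : woType) (x : a) (y : wo_seg x) :
  ord_eq (wo_seg y) (wo_seg (sval y)).
Proof.
apply: (@ord_eq_bij _ (wo_seg (sval y))
  (fun z : wo_seg y => exist _ (sval (sval z)) (svalP z))) => //.
move=> [z zy]; have zx : ~~ wo_le x z.
  exact: (wo_le_lt_trans (wo_ltW zy) (svalP y)).
by exists (exist _ (exist _ z zx : wo_seg x) zy); congr exist.
Qed.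

(** A nonempty isomorphism-invariant class of ordinals has a least element. *)
Lemma least_ordP (P : woType -> Prop) :
  (forall a b, ord_eq a b -> P a -> P b) -> (exists a, P a) ->
  is_least_ord P (least_ord P).
Proof.
move=> Piso Pa; suff h : exists a, is_least_ord P a.
  by rewrite /least_ord; case: pselect => // e; exact: projT2 (cid e).
case: Pa => a Pa.
have [[x0 Px0]|noseg] := pselect (exists x : a, P (wo_seg x)); last first.
  exists a; split=> // b Pb; have [//|[x xb]] := ord_comparable a b.
  by case: noseg; exists x; apply: Piso Pb; exact: ord_eq_sym.
have [x Px xmin] := @wo_min a [set x | P (wo_seg x)] x0 Px0.
exists (wo_seg x); split=> // b Pb.
have [//|[y yb]] := ord_comparable (wo_seg x) b.
have /xmin : P (wo_seg (sval y)).
  by apply: Piso Pb; apply: ord_eq_trans (wo_seg_seg y); exact: ord_eq_sym.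
by have /negP := svalP y.
Qed.

Lemma wo_le_strict_mono (a : woType) (h : a -> a) :
  (forall x y, ~~ wo_le y x -> ~~ wo_le (h y) (h x)) -> forall x, wo_le x (h x).
Proof.
move=> hm; apply: wo_ind => x ih; apply: contraT => l.
by have := ih _ l; rewrite (negbTE (hm _ _ l)).
Qed.

Lemma wo_mono_no_seg (a : woType) (x : a) (f : a -> wo_seg x) :
  ~ {mono f : y z / wo_le y z}.
Proof.
move=> fm; have := @wo_le_strict_mono a (fun y => sval (f y)) _ x.
rewrite (negbTE (svalP (f x))) => h; suff : false by [].
by apply: h => y z; have := fm z y; rewrite /= => ->.
Qed.

Lemma ord_le_wo_sub (a : woType) (P : set a) : ord_le (wo_sub P) a.
Proof.
have [//|[x /ord_eq_sym[f [fm _]]]] := ord_comparable (wo_sub P) a.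
have h y : ~~ wo_le (sval x) (sval (sval (f y))) by exact: (svalP (f y)).
pose k : a -> wo_seg (sval x) := fun y => exist _ (sval (sval (f y))) (h y).
by have [] := @wo_mono_no_seg a (sval x) k; move=> y z; rewrite -fm.
Qed.

Lemma ord_le_anti (a b : woType) : ord_le a b -> ord_le b a -> ord_eq a b.
Proof.
move=> [f [fm fi]] [g [gm _]]; apply: (@ord_eq_bij _ _ f) => // y.
apply: (fi (g y)); apply: wo_le_strict_mono (f \o g) _ y => u v /=.
by rewrite fm gm.
Qed.

(** * Minimal cardinalities and families of fewer than d functions *)

Lemma exists_wo_on (T : Type) : exists (a : woType) (e : a -> T), bijective e.
Proof.
exists (WoType (projT2 (wochoice.well_ordering_principle {classic T}))).
by exists id; exists id.
Qed.

Lemma ord_le_inj (a b : woType) : ord_le a b -> exists f : a -> b, injective f.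
Proof. by move=> [f [/wo_mono_inj fi _]]; exists f. Qed.

Lemma inj_total (S T : Type) :
  (exists f : S -> T, injective f) \/ (exists f : T -> S, injective f).
Proof.
have [a [e [e' eK e'K]]] := exists_wo_on S.
have [b [d [d' dK d'K]]] := exists_wo_on T.
have [/ord_le_inj[f fi]|[x /ord_eq_sym/ord_eq_le ba]] := ord_comparable a b.
  left; exists (d \o f \o e'); apply: inj_comp (can_inj e'K).
  exact: inj_comp (can_inj dK) fi.
have /ord_le_inj[f fi] := ord_le_trans ba (ord_le_wo_sub _).
right; exists (e \o f \o d'); apply: inj_comp (can_inj d'K).
exact: inj_comp (can_inj eK) fi.
Qed.

Lemma bij_card_eq (T U : Type) (F : set U) (f : T -> U) :
  injective f -> range f = F -> ([set: T] #= F)%card.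
Proof.
move=> fi <-; have : set_bij [set: T] (range f) f.
  by split=> // x y _ _ /fi.
by move=> /(ex_intro _ f)/bijPex[g]; exact: pcard_eq.
Qed.

Lemma card_eq_bij (T U : Type) (F : set U) :
  ([set: T] #= F)%card -> exists2 f : T -> U, injective f & range f = F.
Proof.
move=> /card_bijP[f [g fK gK]]; pose j (x : T) : [set: T] :=
  SigSub (mem_set I : x \in [set: T]).
exists (fun x => val (f (j x))).
  by move=> x y /val_inj/(can_inj fK)/(congr1 val).
apply/seteqP; split=> [_ [x _ <-]|u Fu]; first exact: set_valP.
exists (val (g (SigSub (mem_set Fu)))) => //.
rewrite (_ : j _ = g (SigSub (mem_set Fu))) ?gK //; exact: val_inj.
Qed.

Lemma min_card_exists (T : Type) (P : set T -> Prop) : (exists F, P F) ->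
  is_least_ord (fun k : woType => exists F : set T, P F /\ ([set: k] #= F)%card)
    (min_card P).
Proof.
move=> [F PF]; apply: least_ordP => [a b [f [_ [g fK gK]]]
    [G [PG /card_eq_bij[e ei eG]]]|].
  exists G; split=> //; apply: (@bij_card_eq _ _ _ (e \o g)).
    exact: inj_comp ei (can_inj gK).
  rewrite -eG; apply/seteqP; split=> [_ [x _ <-]|_ [x _ <-]];
    first by exists (g x).
  by exists (f x) => //=; rewrite fK.
have [a [e [e' eK e'K]]] := exists_wo_on T.
exists (wo_sub (e @^-1` F)), F; split=> //.
apply: (@bij_card_eq _ _ _ (fun u => e (sval u))).
  move=> [x Fx] [y Fy] /= /(can_inj eK) xy; subst y.
  by congr exist; exact: Prop_irrelevance.
apply/seteqP; split=> [_ [[x Fx] _ <-] //|x Fx].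
have Fx' : F (e (e' x)) by rewrite e'K.
by exists (exist _ (e' x) Fx') => //=; rewrite e'K.
Qed.

Lemma min_cardP (T : Type) (P : set T -> Prop) : (exists F, P F) ->
  exists2 e : min_card P -> T, injective e & P (range e).
Proof.
move=> /min_card_exists[[F [PF /card_eq_bij[e ei eF]]] _].
by exists e; rewrite ?eF.
Qed.

(** The minimal cardinality is bounded by the order type of any well-ordered
    indexing, possibly with repetitions, of a witness: keep the least index of
    each element. *)
Lemma min_card_le (T : Type) (P : set T -> Prop) (a : woType) (g : a -> T) :
  P (range g) -> ord_le (min_card P) a.
Proof.
move=> Pg; have [_ lst] := min_card_exists (ex_intro _ _ Pg).
pose A := [set x | forall y, g y = g x -> wo_le x y].
apply: ord_le_trans (ord_le_wo_sub A); apply: lst; exists (range g); split=> //.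
apply: (@bij_card_eq _ _ _ (fun u : wo_sub A => g (sval u))).
  move=> [x Ax] [y Ay] /= e; have xy : x = y by apply: wo_anti; auto.
  by subst y; congr exist; exact: Prop_irrelevance.
apply/seteqP; split=> [_ [[x Ax] _ <-]|_ [x _ <-]]; first by exists x.
have [m mx mmin] := @wo_min a [set y | g y = g x] x erefl.
have Am : A m by move=> y ym; apply: mmin; rewrite /= ym.
by exists (exist _ m Am).
Qed.

Lemma le_starP (x y : nat -> nat) :
  le_star x y <-> exists N, forall n, (N <= n)%N -> (x n <= y n)%N.
Proof.
split=> [/finite_seqP[s es]|[N xy]].
  exists (\max_(i <- s) i).+1 => n ns; apply: contrapT => nxy.
  have : n \in s by have : [set` s] n by rewrite -es.
  by move=> /(@leq_bigmax_seq _ _ xpredT id)/(_ isT); rewrite leqNgt ns.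
apply: sub_finite_set (finite_II N) => n /= nxy.
by rewrite ltnNge; apply/negP => /xy.
Qed.

(** A type is small when it has fewer elements than the dominating number, in
    the form: it indexes no dominating family. *)
Definition small (T : Type) : Prop :=
  forall phi : T -> nat -> nat, ~ dominating (range phi).

Lemma small_surj (T S : Type) (f : T -> S) :
  (forall s, exists t, f t = s) -> small T -> small S.
Proof.
move=> fs Ts phi dom; apply: (Ts (phi \o f));
  rewrite (_ : range _ = range phi) //.
apply/seteqP; split=> [_ [x _ <-]|_ [x _ <-]]; first by exists (f x).
by have [t <-] := fs x; exists t.
Qed.

Lemma small_inj (T S : Type) (f : S -> T) : injective f -> small T -> small S.
Proof.
move=> fi Ts phi dom; have [y [s _ _] _] := dom id.
apply: (@small_surj T S (fun t => if pselect (exists s, f s = t) is left h then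
  projT1 (cid h) else s) _ Ts phi dom).
move=> u; exists (f u); case: pselect => [h|[]]; last by exists u.
by apply: fi; exact: projT2 (cid h).
Qed.

Lemma small_nat : small nat.
Proof.
move=> phi /(_ (fun n => (\sum_(i < n.+1) phi i n).+1)) [_ [i _ <-] le].
have /le_starP[N hN] := le.
have := hN (maxn N i) (leq_maxl _ _); apply/negP; rewrite -leqNgt.
by rewrite (bigD1 (inord i)) //= inordK ?leq_addr // ltnS leq_maxr.
Qed.

(** An infinite set has as many finite sequences as elements. Let f be maximal
    among the injections of the finite sequences of some infinite subset A into
    A. If the complement of A embeds in A, then so does the whole of K, and f
    can be transported; otherwise a disjoint copy of A can be added to A. *)
Lemma seq_inj (K : eqType) (i0 : nat -> K) : injective i0 ->
  exists f : seq K -> K, injective f.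
Proof.
move=> i0i.
(* Q R: R is the graph of an injection of the finite sequences of [dom R] into
   [dom R]. *)
pose dom (R : set (seq K * K)) := [set x | exists v, R ([:: x], v)].
pose Q (R : set (seq K * K)) :=
  [/\ forall s v w, R (s, v) -> R (s, w) -> v = w,
      forall s t v, R (s, v) -> R (t, v) -> s = t,
      forall s v, R (s, v) -> dom R v /\ forall x, x \in s -> dom R x &
      forall s, (forall x, x \in s -> dom R x) -> exists v, R (s, v)].
pose R0 : set (seq K * K) := [set u | exists s, u = (map i0 s, i0 (pickle s))].
have domR0 n : dom R0 (i0 n) by exists (i0 (pickle [:: n])), [:: n].
have domR0E x : dom R0 x -> exists n, x = i0 n.
  by move=> [v [[|n []] //= [-> _]]]; exists n.
have QR0 : Q R0.
  split.
  - by move=> s v w [s' [-> ->]] [t' [/(inj_map i0i) -> ->]].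
  - by move=> s t v [s' [-> ->]] [t' [-> /i0i/(pcan_inj pickleK) ->]].
  - move=> s v [s' [-> ->]]; split; first exact: domR0.
    by move=> x /mapP[n _ ->]; exact: domR0.
  - move=> s h; suff [s' ->] : exists s', s = map i0 s'.
      by exists (i0 (pickle s')), s'.
    elim: s h => [|x s ih] h; first by exists [::].
    have [|s' ->] := ih; first by move=> y ys; apply: h; rewrite inE ys orbT.
    by have /domR0E[n ->] := h x (mem_head _ _); exists (n :: s').
have [F FQ Ftot|R1 [QR Rmax]] := @Zorn_bigcup _ (fun R => Q (R0 `|` R)).
  have [[A0 FA0]|F0] := pselect (exists A, F A); last first.
    rewrite (_ : R0 `|` _ = R0) //; apply/seteqP; split=> [u []//|u];
      last by left.
    by move=> [A FA _]; case: F0; exists A.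
  have sub A : F A -> R0 `|` A `<=` R0 `|` \bigcup_(X in F) X.
    by move=> FA; apply: setUS => u Au; exists A.
  have fin (s : seq K) : (forall x, x \in s ->
    dom (R0 `|` \bigcup_(X in F) X) x) ->
      exists2 A, F A & forall x, x \in s -> dom (R0 `|` A) x.
    elim: s => [|x s ih] h; first by exists A0.
    have [|A FA hA] := ih; first by move=> y ys; apply: h; rewrite inE ys orbT.
    have [v xv] := h x (mem_head _ _).
    have [B FB xB] : exists2 B, F B & dom (R0 `|` B) x.
      by case: xv => [xv|[B FB xv]]; [exists A0 => //; exists v; left|
        exists B => //; exists v; right].
    have [AB|BA] := Ftot _ _ FA FB.
      exists B => // y; rewrite inE => /orP[/eqP->//|/hA[w yw]].
      by exists w; exact: (setUS AB yw).
    exists A => // y; rewrite inE => /orP[/eqP->|/hA//].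
    by case: xB => w yw; exists w; exact: (setUS BA yw).
  have one u : (R0 `|` \bigcup_(X in F) X) u -> exists2 A, F A & (R0 `|` A) u.
    by move=> [u0|[A FA Au]]; [exists A0 => //; left|exists A => //; right].
  have two u v : (R0 `|` \bigcup_(X in F) X) u ->
      (R0 `|` \bigcup_(X in F) X) v ->
      exists A, [/\ F A, (R0 `|` A) u & (R0 `|` A) v].
    move=> /one[A FA Au] /one[B FB Bv]; have [AB|BA] := Ftot _ _ FA FB.
      by exists B; split=> //; exact: (setUS AB Au).
    by exists A; split=> //; exact: (setUS BA Bv).
  split.
  - by move=> s v w sv /(two _ _ sv)[A [/FQ[h _ _ _]]]; exact: h.
  - by move=> s t v sv /(two _ _ sv)[A [/FQ[_ h _ _]]]; exact: h.
  - move=> s v /one[A FA /(let: And4 _ _ h _ := FQ _ FA in h _ _)[[w vw] h]].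
    split; first by exists w; exact: (sub _ FA).
    by move=> x /h[w' xw]; exists w'; exact: (sub _ FA).
  - move=> s /fin[A FA h]; have [_ _ _ /(_ s h)[v sv]] := FQ _ FA.
    by exists v; exact: (sub _ FA).
pose R := R0 `|` R1; rewrite -/R in QR.
have [Rf Ri Rd Rt] := QR.
pose A := dom R.
have Ai0 n : A (i0 n) by have [v] := domR0 n; exists v; left.
have /choice[f fP] : forall s : seq K, exists v,
    (forall x, x \in s -> A x) -> R (s, v).
  move=> s; have [/Rt[v sv]|h] := pselect (forall x, x \in s -> A x);
    first by exists v.
  by exists (i0 0%N) => /h.
have fA (s : seq K) : (forall x, x \in s -> A x) -> A (f s) by move=> /fP/Rd[].
have fi (s t : seq K) : (forall x, x \in s -> A x) ->
    (forall x, x \in t -> A x) -> f s = f t -> s = t.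
  by move=> /fP sv /fP tv e; apply: Ri sv _; rewrite e.
(* If B minus A embeds in A through j, then B embeds in A, x being coded by a
   sequence of length one or two, and so do the finite sequences of B. *)
have emb (B : set K) (j : K -> K) : (forall x, B x -> ~ A x -> A (j x)) ->
    (forall x y, B x -> B y -> ~ A x -> ~ A y -> j x = j y -> x = y) ->
    exists g : seq K -> K, (forall s, (forall x, x \in s -> B x) -> A (g s)) /\
      forall s t, (forall x, x \in s -> B x) -> (forall x, x \in t -> B x) ->
        g s = g t -> s = t.
  move=> jA ji.
  have one x : A x -> forall z, z \in [:: x] -> A z.
    by move=> Ax z; rewrite inE => /eqP->.
  have two x : A x -> forall z, z \in [:: x; x] -> A z.
    by move=> Ax z; rewrite !inE orbb => /eqP->.
  pose e x := if pselect (A x) is left _ then f [:: x] else f [:: j x; j x].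
  have eA x : B x -> A (e x).
    rewrite /e; case: pselect => [Ax _|nAx Bx]; apply: fA; first exact: one.
    by apply: two; exact: jA.
  have ei x y : B x -> B y -> e x = e y -> x = y.
    move=> Bx By; rewrite /e.
    case: pselect => [Ax|nAx]; case: pselect => [Ay|nAy] /fi.
    - by case/(_ (one _ Ax) (one _ Ay)).
    - by move=> /(_ (one _ Ax) (two _ (jA _ By nAy))).
    - by move=> /(_ (two _ (jA _ Bx nAx)) (one _ Ay)).
    - case/(_ (two _ (jA _ Bx nAx)) (two _ (jA _ By nAy))) => xy _;
        exact: ji xy.
  have me (s : seq K) : (forall x, x \in s -> B x) ->
      forall x, x \in map e s -> A x.
    by move=> sB x /mapP[y /sB/eA Ay ->].
  exists (f \o map e); split=> [s /me/fA //|s t sB tB /=].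
  move=> /(fi _ _ (me _ sB) (me _ tB)).
  elim: s t sB tB => [|x s ih] [|y t] //= sB tB [/ei -> //];
    rewrite ?mem_head //.
  - by move/ih => -> // z zs; [apply: sB|apply: tB]; rewrite inE zs orbT.
  - by apply: sB; rewrite mem_head.
  - by apply: tB; rewrite mem_head.
have [[j ji]|[j ji]] := inj_total {x | ~ A x} {x | A x}.
  pose j' x := if pselect (A x) is right h then sval (j (exist _ x h)) else x.
  have [||g [_ gi]] := emb setT j'.
  - by move=> x _ h; rewrite /j'; case: pselect => // h'; exact: (svalP (j _)).
  - move=> x y _ _ nAx nAy; rewrite /j'; case: pselect => // h;
      case: pselect => // h'.
    by move=> e; have /ji/(congr1 sval) := eq_sig _ _ e (Prop_irrelevance _ _).
  by exists g => s t; exact: gi.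
(* Now j' maps A to a disjoint copy, and f extends to the sequences of the union
   B, the new ones being sent to the copy. *)
pose j' x := if pselect (A x) is left h then sval (j (exist _ x h)) else x.
have j'A x : A x -> ~ A (j' x).
  by move=> Ax; rewrite /j'; case: pselect => // h; exact: (svalP (j _)).
have j'i x y : A x -> A y -> j' x = j' y -> x = y.
  move=> Ax Ay; rewrite /j'; case: pselect => // h; case: pselect => // h'.
  by move=> e; have /ji/(congr1 sval) := eq_sig _ _ e (Prop_irrelevance _ _).
pose B : set K := A `|` j' @` A.
have /choice[k kP] : forall x, exists y, B x -> ~ A x -> A y /\ j' y = x.
  move=> x; have [[//|[y Ay yx]]|nB] := pselect (B x); first by exists x.
    by exists y.
  by exists x.
have [||g [gA gi]] := emb B k.
- by move=> x Bx nAx; have [] := kP x Bx nAx.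
- by move=> x y Bx By nAx nAy e; rewrite -(kP x Bx nAx).2 e (kP y By nAy).2.
pose R2 : set (seq K * K) := [set u | [/\ forall x, x \in u.1 -> B x,
   ~ (forall x, x \in u.1 -> A x) & u.2 = j' (g u.1)]].
have domE : dom (R `|` R2) = B.
  apply/seteqP; split=> [x [v [xv|[/(_ x (mem_head _ _)) //]]]|x Bx].
    by left; exists v.
  have [[v xv]|nAx] := pselect (A x); first by exists v; left.
  exists (j' (g [:: x])); right; split=> // [y|/(_ x (mem_head _ _)) //].
  by rewrite inE => /eqP->.
exfalso; apply: (Rmax (R1 `|` R2)).
  split; first by move=> u; left.
  pose x1 := j' (i0 0%N); have nA1 : ~ A x1 by exact: j'A.
  have : R2 ([:: x1], j' (g [:: x1])).
    split=> // [y|/(_ x1 (mem_head _ _)) //]; rewrite inE => /eqP->.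
    by right; exists (i0 0%N).
  move=> r2 /(_ ([:: x1], j' (g [:: x1])) (or_intror r2)) r1.
  by apply: nA1; eexists; right; exact: r1.
rewrite setUA -/R.
have RA s v : R (s, v) -> forall x, x \in s -> A x by move=> /Rd[].
have Rv s v : R (s, v) -> A v by move=> /Rd[].
split.
- move=> s v w [sv|[/= sB nsA ->]] [sw|[/= tB ntA ->]] //.
  + exact: Rf sv sw.
  + by case: ntA; exact: RA sv.
  + by case: nsA; exact: RA sw.
- move=> s t v [sv|[/= sB nsA ev]] [tv|[/= tB ntA ev']].
  + exact: Ri sv tv.
  + by case: (j'A (g t) (gA _ tB)); rewrite -ev'; exact: Rv sv.
  + by case: (j'A (g s) (gA _ sB)); rewrite -ev; exact: Rv tv.
  + by apply: gi => //; apply: j'i; rewrite -?ev -?ev' //; exact: gA.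
- move=> s v [sv|[/= sB nsA ->]]; rewrite domE.
    by split; [left; exact: Rv sv|move=> x /(RA _ _ sv); left].
  by split=> //; right; exists (g s) => //; exact: gA.
- rewrite domE => s sB; have [/Rt[v sv]|nsA] :=
    pselect (forall x, x \in s -> A x).
    by exists v; left.
  by exists (j' (g s)); right.
Qed.

Lemma small_seq_sum (T S : Type) : small T -> small S -> small (seq (T + S)).
Proof.
move=> Ts Ss.
suff [K [Ks [i ii] [eT eTi] [eS eSi]]] : exists K : Type, [/\ small K,
    exists i : nat -> K, injective i, exists i : T -> K, injective i &
    exists i : S -> K, injective i].
  have [f fi] := @seq_inj {classic K} i ii.
  pose j (u : T + S) := match u with inl t => f [:: eT t] | inr s => f [:: eS s;
    eS s] end.
  have ji : injective j by move=> [t|s] [t'|s'] /fi [] // => [/eTi|/eSi] ->.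
  exact: small_inj (inj_comp fi (inj_map ji)) Ks.
have max2 X Y : small X -> small Y -> exists K, [/\ small K,
    exists i : X -> K, injective i & exists i : Y -> K, injective i].
  move=> Xs Ys; have [[f fi]|[f fi]] := inj_total X Y; [exists Y|exists X];
    split=> //.
  - by exists f.
  - by exists id.
  - by exists id.
  - by exists f.
have [K [Ks [i ii] [j ji]]] := max2 _ _ Ts Ss.
have [L [Ls [i' i'i] [j' j'i]]] := max2 _ _ small_nat Ks.
exists L; split=> //; first by exists i'.
  by exists (j' \o i); exact: inj_comp.
by exists (j' \o j); exact: inj_comp.
Qed.

(** * Involutions and finitely dominating sets *)

Lemma subgroupP (G : set sym) : subgroup G <->
  [/\ G 1%g, forall p q, G p -> G q -> G (p * q)%g & forall p, G p ->
    G (p^-1)%g].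
Proof.
split=> [[G1 GD]|[G1 GM GV]].
  have {}G1 : G 1%g by rewrite inE in G1.
  have {}GD p q : G p -> G q -> G (p / q)%g.
    by move=> Gp Gq; have := GD p q; rewrite !inE; apply.
  have GV p : G p -> G (p^-1)%g by move=> Gp; rewrite -(mul1g (p^-1)%g);
    exact: GD.
  by split=> // p q Gp Gq; rewrite -(invgK q); apply: GD => //; exact: GV.
split; first by rewrite inE.
by move=> p q; rewrite !inE => Gp Gq; apply: GM => //; exact: GV.
Qed.

Lemma smallest_subgroup (X : set sym) : subgroup (smallest subgroup X).
Proof.
apply/subgroupP; split.
- by move=> H [/subgroupP[]].
- move=> p q Xp Xq H [sH XH]; have /subgroupP[_ HM _] := sH.
  by apply: HM; [exact: Xp|exact: Xq].
- move=> p Xp H [sH XH]; have /subgroupP[_ _ HV] := sH.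
  by apply: HV; exact: Xp.
Qed.

(** A self-inverse function as a permutation. *)
Definition involution (s : nat -> nat) (sK : involutive s) : sym := Sym sK sK.

(** Every permutation is a product of two involutions: on each orbit, with a
    base point r, reflect p ^ k r to p ^ (- k) r. *)
Lemma sym_two_involutions (p : sym) :
  exists (s t : nat -> nat) (sK : involutive s) (tK : involutive t),
    p = (involution tK * involution sK)%g.
Proof.
have itI n : injective (iter n p).
  by elim: n => [|n ih] x y //= /(can_inj (sym_funK p))/ih.
have itC m n x : iter m p (iter n p x) = iter n p (iter m p x).
  by rewrite -!iterD addnC.
have itV n x : exists y, iter n p y = x.
  elim: n x => [|n ih] x; first by exists x.
  have [y yx] := ih (sym_inv p x); exists y.
  by rewrite iterS yx sym_invK.
pose orb x := [set y | exists m n, iter m p x = iter n p y].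
have orb_refl x : orb x x by exists 0%N, 0%N.
have orb_sym x y : orb x y -> orb y x by move=> [m [n e]]; exists n, m.
have orb_trans x y z : orb x y -> orb y z -> orb x z.
  move=> [m [n e]] [m' [n' e']]; exists (m' + m)%N, (n + n')%N.
  by rewrite !iterD e itC e'.
have orbE x y : orb x y -> orb x = orb y.
  move=> xy; apply/seteqP; split=> z; first by apply: orb_trans; exact: orb_sym.
  exact: orb_trans.
pose r x := xget 0%N (orb x).
have rP x : orb x (r x) by apply: (@xgetPex _ 0%N (orb x)); exists x.
have rE x y : orb x y -> r x = r y by move=> /orbE e; rewrite /r e.
have /choice[s sP] : forall x, exists y, exists m n,
    iter m p x = iter n p (r x) /\ iter n p y = iter m p (r x).
  move=> x; have [m [n e]] := rP x; have [y ye] := itV n (iter m p (r x)).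
  by exists y, m, n.
(* The value of s does not depend on the exponents. *)
have key x m n : iter m p x = iter n p (r x) -> iter n p (s x) = iter m p (r x).
  have [m0 [n0 [e0 e0']]] := sP x => e; apply: (itI n0).
  rewrite itC e0' -!iterD.
  have : iter (m + n0) p (r x) = iter (m0 + n) p (r x).
    by rewrite !iterD -e0 -e itC.
  by rewrite addnC [(n + _)%N]addnC => ->.
have rs x : r (s x) = r x.
  have [m [n [_ e]]] := sP x; apply/esym/rE.
  by apply: orb_trans (rP x) _; apply: orb_sym; exists n, m.
have rp x : r (p x) = r x by apply: rE; exists 0%N, 1%N.
have sK : involutive s.
  move=> x; have [m [n [e e']]] := sP x; apply: (itI m).
  by rewrite (key (s x) n m) rs.
have sps x : p (s (p (s x))) = x.
  have [m [n [e e']]] := sP x; apply: (itI m).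
  by rewrite -iterSr (key (p (s x)) n m.+1) rp rs // -iterSr iterS e'.
have tK : involutive (p \o s) by move=> x /=; exact: sps.
exists s, (p \o s), sK, tK; apply: sym_ext => x /=.
by rewrite sK.
Qed.

(** An involution restricted to an invariant set of points. *)
Lemma restrict_involutive (s : nat -> nat) (J : pred nat) : involutive s ->
  (forall x, J (s x) = J x) -> involutive (fun x => if J x then s x else x).
Proof. by move=> sK Js x; case: (boolP (J x)) => [Jx|/negbTE->//];
  rewrite Js Jx sK. Qed.

(** If a subgroup contains S_(f + id) for each of finitely many f, and the
    maximum of these bounds an involution, then it contains this involution:
    almost every transposed pair x < y is bounded by one of the f at x, so the
    involution splits into commuting involutions each bounded by one of them. *)
Lemma involution_in_subgroup (G : set sym) (n : nat) (f : 'I_n.+1 -> nat -> nat)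
    (s : nat -> nat) (sK : involutive s) :
  subgroup G ->
  (forall i, {homo f i : x y / (x <= y)%N}) ->
  (forall i, S_gen (fun x => f i x + x)%N `<=` G) ->
  le_star s (fun x => \max_(i < n.+1) f i x) -> G (involution sK).
Proof.
move=> /subgroupP[G1 GM GV] fm fG /le_starP[N sN].
pose lo x := minn x (s x); pose hi x := maxn x (s x).
(* The index of a function bounding the pair of x; the finitely many pairs
   without such a function get index 0. *)
pose a x := fun i => (hi x <= f (inord i) (lo x))%N.
pose j x := if (lo x < N)%N then 0%N else find (a x) (iota 0 n.+1).
have los x : lo (s x) = lo x by rewrite /lo sK minnC.
have his x : hi (s x) = hi x by rewrite /hi sK maxnC.
have js x : j (s x) = j x by rewrite /j /a los his.
have has_a x : (N <= lo x)%N -> has (a x) (iota 0 n.+1).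
  move=> Nx; apply: contraT => /hasPn na.
  have h : (hi x <= \max_(i < n.+1) f i (lo x))%N.
    rewrite (_ : hi x = s (lo x)) ?sN //.
    by rewrite /hi /lo; case: (ltngtP x (s x)) => // _; rewrite sK.
  have lt (i : 'I_n.+1) : (f i (lo x) < hi x)%N.
    have := na i; rewrite mem_iota /= add0n ltn_ord /a inord_val -ltnNge.
    exact.
  have : (\max_(i < n.+1) f i (lo x) <= (hi x).-1)%N.
    by apply/bigmax_leqP => i _; rewrite -ltnS (ltn_predK (lt i)).
  move=> /(leq_trans h); have := lt ord0; case: (hi x) => // y _ /=.
  by rewrite ltnn.
have jlt x : (j x < n.+1)%N.
  rewrite /j; case: (ltnP (lo x) N) => // /has_a; rewrite has_find size_iota.
  exact.
have jP x : (N <= lo x)%N -> (hi x <= f (inord (j x)) (lo x))%N.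
  move=> Nx; have := nth_find 0%N (has_a x Nx).
  have lN : (lo x < N)%N = false by rewrite ltnNge Nx.
  by have := jlt x; rewrite /j lN => lt; rewrite nth_iota.
have sub_G m (p : sym) : (m < n.+1)%N -> (forall x, p (p x) = x) ->
    (forall x, p x = if j x == m then s x else x) -> G p.
  move=> mn pK pE; apply: (fG (inord m)) => H [_]; apply.
  suff ps : le_star p (fun x => f (inord m) x + x)%N.
    split=> //; rewrite (_ : p^-1 = p)%g //; apply: sym_ext => x.
    by rewrite -{1}[x]pK; exact: sym_funK.
  apply/le_starP; exists (N + \max_(i < N) (s i).+1)%N => x.
  rewrite pE; case: eqP => [<-|_] xN; last exact: leq_addl.
  have Nlo : (N <= lo x)%N.
    rewrite /lo leq_min (leq_trans (leq_addr _ _) xN) /= leqNgt;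
      apply/negP => h.
    have := @leq_bigmax 'I_N (fun i => (s i).+1) (Ordinal h).
    by rewrite /= sK ltnNge (leq_trans (leq_addl _ _) xN).
  apply: leq_trans (leq_addr _ _); apply: leq_trans (leq_maxr x (s x)) _.
  by apply: leq_trans (jP x Nlo) _; apply: fm; exact: geq_minl.
have ind m (p : sym) : (m <= n.+1)%N ->
    (forall x, p x = if (j x < m)%N then s x else x) -> G p.
  elim: m p => [|m ih] p mn pE; first by rewrite (_ : p = 1%g) //;
    exact: sym_ext.
  have Jl x : (j (s x) < m)%N = (j x < m)%N by rewrite js.
  have Je x : (j (s x) == m) = (j x == m) by rewrite js.
  rewrite (_ : p = (involution (restrict_involutive sK Jl) *
                    involution (restrict_involutive sK Je))%g); last first.
    apply: sym_ext => x /=; rewrite pE ltnS leq_eqVlt.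
    case: eqP => [e|_] //=.
    by rewrite js e ltnn.
  apply: GM; first by apply: ih => //; exact: ltnW.
  by apply: (sub_G m) => // x; exact: (restrict_involutive sK Je).
by apply: (ind n.+1) => // x; rewrite jlt.
Qed.

Lemma increasing_addn (f : nat -> nat) : {homo f : m n / (m <= n)%N} ->
  increasing (fun x => f x + x)%N.
Proof. by move=> fm m n mn; rewrite -addnS leq_add // fm // ltnW. Qed.

(** The nondecreasing unbounded functions f for which G contains the group of
    f + id. *)
Definition captured (G : set sym) : set (nat -> nat) :=
  [set f | unbounded_nondecreasing f /\ S_gen (fun x => f x + x)%N `<=` G].

Lemma captured_not_finitely_dominating (G : set sym) :
  subgroup G -> G <> setT -> ~ finitely_dominating (captured G).
Proof.
move=> sG GT Gfd; apply: GT; apply/seteqP; split=> // p _.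
have inv s (sK : involutive s) : G (involution sK).
  have [n [f [fG sf]]] := Gfd s.
  apply: (involution_in_subgroup sK sG _ _ sf) => i; first exact: (fG i).1.1.
  exact: (fG i).2.
have [s [t [sK [tK ->]]]] := sym_two_involutions p.
by have /subgroupP[_ GM _] := sG; apply: GM.
Qed.

Lemma captured_bigcup (l : woType) (G : l -> set sym) : cf_star_chain G ->
  \bigcup_(A in range (fun i => captured (G i))) A = unbounded_nondecreasing.
Proof.
move=> [_ _ _ GS]; apply/seteqP; split=> [f [_ [i _ <-] []//]|f uf].
have [i fi] := GS _ (increasing_addn uf.1).
by exists (captured (G i)).
Qed.

(** A chain yields a covering family indexed by its length. *)
Lemma cov_Dfin_le_chain (l : woType) (G : l -> set sym) : cf_star_chain G ->
  ord_le cov_Dfin l.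
Proof.
move=> Gc; apply: (@min_card_le _ _ _ (fun i => captured (G i))).
split; last exact: captured_bigcup Gc.
have [sG _ _ _] := Gc.
move=> _ [i _ <-]; split=> [f []//|].
by have [? ?] := sG i; exact: captured_not_finitely_dominating.
Qed.

(** * A chain of subgroups of length d *)

Lemma dominating_exists : exists D : set (nat -> nat), dominating D.
Proof. by exists setT => x; exists x => //; apply/le_starP; exists 0%N. Qed.

Lemma not_dominating_le_small (a : woType) : ~ ord_le dominating_number a ->
    small a.
Proof. by move=> na phi /(@min_card_le _ dominating a phi). Qed.

Lemma small_seg (a : dominating_number) : small (wo_seg a).
Proof. by apply: not_dominating_le_small => -[f [/wo_mono_no_seg]]. Qed.

Lemma le_star_trans (x y z : nat -> nat) : le_star x y -> le_star y z ->
    le_star x z.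
Proof.
move=> /le_starP[N xy] /le_starP[M yz]; apply/le_starP; exists (maxn N M) => n.
by rewrite geq_max => /andP[/xy h /yz]; exact: leq_trans.
Qed.

Lemma le_starW (x y : nat -> nat) : (forall n, (x n <= y n)%N) -> le_star x y.
Proof. by move=> xy; apply/le_starP; exists 0%N. Qed.

(** A strictly increasing majorant of f. *)
Definition hat (f : nat -> nat) (n : nat) : nat := (n + \sum_(i < n.+1) f i)%N.

Lemma le_hat (f : nat -> nat) (n : nat) : (f n <= hat f n)%N.
Proof. by rewrite /hat big_ord_recr /= addnA leq_addl. Qed.

Lemma hat_increasing (f : nat -> nat) : increasing (hat f).
Proof.
apply: homo_ltn => [y x z|n]; first exact: ltn_trans.
by rewrite /hat [X in (_ < _ + X)%N]big_ord_recr /= addSn ltnS leq_add2l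
  leq_addr.
Qed.

Lemma increasing_le (f : nat -> nat) : increasing f ->
  forall m n, (f m <= f n)%N = (m <= n)%N.
Proof. by move=> fi; exact: leq_mono. Qed.

Lemma increasing_ge_id (f : nat -> nat) : increasing f ->
    forall n, (n <= f n)%N.
Proof. by move=> fi; elim=> // n ih; exact: leq_ltn_trans ih (fi _ _ _). Qed.

Lemma sym_ge (p : sym) (N : nat) : exists M, forall n, (M <= n)%N ->
    (N <= p n)%N.
Proof.
exists (\max_(i < N) ((p^-1)%g i).+1) => n; apply: contraTT;
  rewrite -!ltnNge => h.
have := @leq_bigmax 'I_N (fun i => ((p^-1)%g i).+1) (Ordinal h).
by rewrite /= sym_funK.
Qed.

Lemma le_star_comp (p q : sym) (g h : nat -> nat) :
  {homo g : m n / (m <= n)%N} -> le_star p g -> le_star q h ->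
  le_star (p * q)%g (g \o h).
Proof.
move=> gm /le_starP[N pg] /le_starP[M qh]; have [L qL] := sym_ge q N.
apply/le_starP; exists (maxn M L) => n; rewrite geq_max => /andP[Mn Ln] /=.
by apply: leq_trans (pg _ (qL _ Ln)) _; apply/gm/qh.
Qed.

(** A permutation exchanging 2 * i with 2 * h i + 1. *)
Lemma sym_above (h : nat -> nat) : injective h ->
  exists p : sym, forall i, p i.*2 = (h i).*2.+1.
Proof.
move=> hi.
pose s n := if odd n then
    (if pselect (exists i, h i = n./2) is left e then (projT1 (cid e)).*2 else
      n)
  else (h n./2).*2.+1.
have s0 i : s i.*2 = (h i).*2.+1 by rewrite /s odd_double doubleK.
have s1 i : s (h i).*2.+1 = i.*2.
  rewrite /s /= odd_double /= uphalf_double; case: pselect => [e|[]];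
    last by exists i.
  by case: (cid e) => j /= /hi->.
have sK : involutive s.
  move=> n; have [nodd|/negbTE neven] := boolP (odd n); last first.
    by rewrite -(odd_double_half n) neven add0n s0 s1.
  have [[i hin]|nh] := pselect (exists i, h i = n./2).
    by rewrite -(odd_double_half n) nodd -hin add1n s1 s0.
  have sn : s n = n by rewrite /s nodd; case: pselect.
  by rewrite !sn.
by exists (involution sK).
Qed.


(** The subgroups of the chain of length d: the a-th one is generated by the
    permutations bounded by a strictly increasing majorant of e b for b <= a. *)
Definition dominated_subgroup (D : woType) (e : D -> nat -> nat)
    (a : D) : set sym :=
  smallest subgroup [set p : sym | exists b, [/\ wo_le b a,
    le_star p (hat (e b)) & le_star (p^-1)%g (hat (e b))]].

(** The dominated subgroups are proper: their elements are bounded by finite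
    compositions, of which there are fewer than d. *)
Lemma dominated_subgroup_proper (e : dominating_number -> nat -> nat)
  (a : dominating_number) : dominated_subgroup e a <> setT.
Proof.
pose T := (wo_seg a + unit)%type.
pose c (t : T) := match t with inl b => hat (e (sval b)) | inr _ => hat (e a)
  end.
pose bnd (s : seq T) := foldr (fun t g => c t \o g) id s.
have cm t : {homo c t : m n / (m <= n)%N}.
  by case: t => [b|u] m n; rewrite (increasing_le (@hat_increasing _)).
have compm s : {homo bnd s : m n / (m <= n)%N}.
  by elim: s => [|t s ih] m n mn //=; apply/cm/ih.
have compD s s' : bnd (s ++ s') = bnd s \o bnd s' by elim: s => //= t s ->.
pose H := [set p : sym | exists s s', le_star p (bnd s) /\ le_star (p^-1)%g (bnd
  s')].
have HS : subgroup H.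
  apply/subgroupP; split.
  - by exists [::], [::]; split; exact: le_starW.
  - move=> p q [s [s' [ps ps']]] [t [t' [qt qt']]]; exists (s ++ t), (t' ++ s').
    by rewrite invgM !compD; split; apply: le_star_comp.
  - by move=> p [s [s' [ps ps']]]; exists s', s; rewrite invgK.
have GH : dominated_subgroup e a `<=` H.
  apply: smallest_sub => // p [b [ba pb pb']].
  suff [t tb] : exists t, c t = hat (e b) by exists [:: t], [:: t];
    rewrite /= tb.
  have [ab|nab] := boolP (wo_le a b); last by exists (inl (exist _ b nab)).
  by exists (inr tt); rewrite (wo_anti ba ab).
move=> GT; have us : small unit.
  by apply: (@small_inj nat unit (fun=> 0%N)) small_nat => -[] [].
have /(_ (fun s n => bnd s n.*2)) := small_seq_sum (@small_seg a) us; apply=> x.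
have [q qE] := sym_above (incn_inj (increasing_le (@hat_increasing x))).
have [s [_ [/le_starP[N qs] _]]] : H q by apply: GH; rewrite GT.
exists (fun n => bnd s n.*2); first by exists s.
apply/le_starP; exists N => n Nn.
apply: leq_trans (qs n.*2 _); last by rewrite (leq_trans Nn) // -addnn leq_addr.
rewrite qE; apply: leq_trans (le_hat x n) _.
by rewrite -addnn -addnS leq_addr.
Qed.

Lemma dominated_subgroup_chain (e : dominating_number -> nat -> nat) :
  dominating (range e) -> cf_star_chain (dominated_subgroup e).
Proof.
move=> edom; split.
- move=> a; split; [exact: smallest_subgroup|exact: dominated_subgroup_proper].
- move=> a b ab; apply: smallest_sub; first exact: smallest_subgroup.
  move=> p [c [ca pc pc']]; apply: sub_gen_smallest; exists c; split=> //.
  exact: wo_trans ca ab.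
- apply/seteqP; split=> // p _; have [_ [b _ <-] le] :=
    edom (fun n => p n + (p^-1)%g n)%N.
  exists b => //; apply: sub_gen_smallest; exists b; split;
    first exact: wo_refl.
    apply: le_star_trans (le_starW (le_hat _)); apply: le_star_trans le.
    by apply: le_starW => n; exact: leq_addr.
  apply: le_star_trans (le_starW (le_hat _)); apply: le_star_trans le.
  by apply: le_starW => n; exact: leq_addl.
- move=> f fi; have [_ [b _ <-] le] := edom f; exists b.
  apply: smallest_sub => [|p [pf pf']]; first exact: smallest_subgroup.
  have le' := le_star_trans le (le_starW (le_hat _)).
  by apply: sub_gen_smallest; exists b; split;
     [exact: wo_refl|exact: le_star_trans le'|exact: le_star_trans le'].
Qed.

Lemma cf_star_exists : is_least_ord
  (fun l : woType => exists G : l -> set sym, cf_star_chain G) cf_star_Sym.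
Proof.
apply: least_ordP => [a b [f [fm [g fK gK]]] [G [G1 G2 G3 G4]]|].
  exists (G \o g); split=> [i|i j ij||h /G4[i hi]].
  - exact: G1.
  - by apply: G2; rewrite -fm !gK.
  - by rewrite -G3; apply/seteqP; split=> p [i _ pi];
      [exists (g i)|exists (f i); rewrite //= fK].
  - by exists (f i); rewrite /= fK.
have [e _ edom] := min_cardP dominating_exists.
by exists dominating_number, (dominated_subgroup e);
  exact: dominated_subgroup_chain.
Qed.

Lemma cf_star_le_dominating : ord_le cf_star_Sym dominating_number.
Proof.
have [e _ edom] := min_cardP dominating_exists.
by apply: cf_star_exists.2; exists (dominated_subgroup e);
  exact: dominated_subgroup_chain.
Qed.

Lemma cov_Dfin_le_cf_star : ord_le cov_Dfin cf_star_Sym.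
Proof. by have [[G /cov_Dfin_le_chain]] := cf_star_exists. Qed.

(** * Free ultrafilters, hulls and coherence *)

(** A free ultrafilter on nat: one that contains the final segments. *)
Definition free_ultra (U : set_system nat) : Prop :=
  UltraFilter U /\ forall N, U [set n | (N <= n)%N].

Lemma free_ultra_nonprincipal (U : set_system nat) : free_ultra U ->
    nonprincipal U.
Proof.
move=> [UU Ufree] A UA.
have [[a Aa]|A0] := pselect (A !=set0); last first.
  apply: (@filter_not_empty _ U); rewrite UA => x Ax.
  by case: A0; exists x.
have := Ufree a.+1; rewrite UA => /(_ a Aa) /=.
by rewrite ltnn.
Qed.

Lemma free_ultra_meet (U : set_system nat) (A : set nat) (N : nat) :
  free_ultra U -> U A -> exists2 n, (N <= n)%N & A n.
Proof.
move=> [UU Ufree] UA; have [n [Nn An]] := filter_ex (filterI (Ufree N) UA).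
by exists n.
Qed.

Lemma ultra_dichotomy (T : Type) (F : set_system T) : ProperFilter F ->
  (forall A, F A \/ F (~` A)) -> UltraFilter F.
Proof.
move=> PF dich; split=> // G PG FG; apply/seteqP; split=> // A GA.
have [//|/FG GnA] := dich A.
have GAA : G (A `&` ~` A) by exact: filterI.
by have [x []] := filter_ex GAA.
Qed.

(** Any finitely many members have infinite intersection. *)
Definition sfip (F : set (set nat)) : Prop :=
  forall (s : seq (set nat)) (N : nat), (forall A, A \in s -> F A) ->
    exists2 n, (N <= n)%N & forall A, A \in s -> A n.

Lemma sfip_free_ultra (F : set (set nat)) : sfip F ->
  exists2 U, free_ultra U & F `<=` U.
Proof.
move=> Ff; pose G : set_system nat := [set B | exists (s : seq (set nat)) N,
  (forall A, A \in s -> F A) /\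
  forall n, (N <= n)%N -> (forall A, A \in s -> A n) -> B n].
have GP : ProperFilter G.
  split.
    by move=> [s [N [sF s0]]]; have [n Nn sn] := Ff s N sF; exact: (s0 n Nn sn).
  split=> [|A B [s [N [sF sA]]] [t [M [tF tB]]]|A B AB [s [N [sF sA]]]].
  - by exists [::], 0%N.
  - exists (s ++ t), (maxn N M); split=> [C|n].
      by rewrite mem_cat => /orP[/sF|/tF].
    rewrite geq_max => /andP[Nn Mn] h; split.
      by apply: sA => // C Cs; apply: h; rewrite mem_cat Cs.
    by apply: tB => // C Cs; apply: h; rewrite mem_cat Cs orbT.
  - by exists s, N; split=> // n Nn /(sA _ Nn)/AB.
have [U [UU GU]] := ultraFilterLemma GP; exists U.
  by split=> // N; apply: GU; exists [::], N.
move=> A FA; apply: GU; exists [:: A], 0%N; split=> [B|n _ h].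
  by rewrite inE => /eqP->.
by apply: h; rewrite mem_head.
Qed.

Lemma free_ultra_exists : exists U, free_ultra U.
Proof.
have [|U Uf _] := @sfip_free_ultra set0; last by exists U.
by move=> [|A s] N h; [exists N|case: (h A (mem_head _ _))].
Qed.

(** The points m near some a in A, in the sense that a <= g m and m <= g a. *)
Definition hull (g : nat -> nat) (A : set nat) : set nat :=
  [set m | exists a, [/\ A a, (a <= g m)%N & (m <= g a)%N]].

Lemma increasing_blocks (k : nat -> nat) : increasing k ->
  exists h : nat -> nat, forall n, (k 0%N <= n)%N ->
    (k (h n) <= n < k (h n).+1)%N.
Proof.
move=> ki.
suff /choice[h hP] : forall n, exists m, (k 0%N <= n)%N ->
  (k m <= n < k m.+1)%N.
  by exists h.
move=> n; have ex : exists m, (n < k m.+1)%N by exists n;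
  exact: increasing_ge_id.
exists (ex_minn ex) => k0n; case: ex_minnP => -[|m] nm mmin;
  first by rewrite k0n.
by rewrite nm andbT leqNgt; apply/negP => /mmin; rewrite ltnn.
Qed.

Lemma increasing_lt (k : nat -> nat) : increasing k ->
    forall m n, (k m < k n)%N = (m < n)%N.
Proof. by move=> ki m n; rewrite !ltnNge (increasing_le ki). Qed.

(** If U and V are coherent through the blocks [k n, k n.+1), then V contains
    the hull of each member of U, for every g eventually above n |-> k n.+1: two
    points in one block are near each other. *)
Lemma coherent_hull (U V : set_system nat) (k g : nat -> nat) (A : set nat) :
  free_ultra U -> free_ultra V -> increasing k ->
  (forall I : set nat, U (\bigcup_(n in I) [set m | (k n <= m < k n.+1)%N]) <->
     V (\bigcup_(n in I) [set m | (k n <= m < k n.+1)%N])) ->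
  le_star (k \o succn) g -> U A -> V (hull g A).
Proof.
move=> [UU Ufree] [VU Vfree] ki UV /le_starP[N kg] UA.
have [h hP] := increasing_blocks ki.
pose I := [set m | exists a, [/\ A a, (N <= a)%N & (k m <= a < k m.+1)%N]].
have /UV VI : U (\bigcup_(n in I) [set m | (k n <= m < k n.+1)%N]).
  apply: filterS (filterI UA (filterI (Ufree N) (Ufree (k 0%N)))) => a [Aa [/=
    Na ka]].
  by exists (h a); [exists a; split=> //|]; exact: hP.
have kb m x y : (k m <= x)%N -> (k m <= y)%N -> (y < k m.+1)%N ->
  (y <= k x.+1)%N.
  move=> mx my ym; apply: leq_trans (ltnW ym) _;
    rewrite (increasing_le ki) ltnS.
  exact: leq_trans (increasing_ge_id ki _) mx.
apply: filterS (filterI VI (Vfree N)) => x [[m [a [Aa Na /andP[ma am]] /andP[mx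
  xm]]] Nx].
exists a; split=> //.
- by apply: leq_trans (kg _ Nx); apply: (kb m).
- by apply: leq_trans (kg _ Na); apply: (kb m).
Qed.

(** A free ultrafilter with a small base. *)
Definition small_ultra (W : set_system nat) : Prop := free_ultra W /\
  exists (T : Type) (c : T -> set nat), [/\ small T, forall t, W (c t) &
    forall B, W B -> exists t, c t `<=` B].

(** The intersection of finitely many members of a family and of final
    segments. *)
Fixpoint meets (T : Type) (b : T -> set nat) (s : seq (T + nat)) : set nat :=
  match s with
  | [::] => setT
  | inl t :: s => b t `&` meets b s
  | inr N :: s => [set n | (N <= n)%N] `&` meets b s
  end.

Lemma meets_cat (T : Type) (b : T -> set nat) (s t : seq (T + nat)) :
  meets b (s ++ t) = meets b s `&` meets b t.
Proof. by elim: s => [|[u|N] s /= ->]; rewrite ?setTI ?setIA. Qed.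

Lemma sfip_meets (T : Type) (b : T -> set nat) (A : set nat) :
  (forall s, meets b s `&` A !=set0) -> sfip (range b `|` [set A]).
Proof.
move=> h s N sb.
suff [t tP] : exists t, forall n, meets b t n -> A n -> forall B, B \in s ->
  B n.
  have [n [[/= Nn tn] An]] := h (inr N :: t).
  by exists n => //; exact: tP.
elim: s sb => [|B s ih] sb; first by exists [::].
have [|t tP] := ih; first by move=> C Cs; apply: sb; rewrite inE Cs orbT.
have [[u _ uB]|->] := sb B (mem_head _ _).
  exists (inl u :: t) => n [un tn] An C; rewrite inE => /orP[/eqP->|];
    last exact: tP.
  by rewrite -uB.
exists t => n tn An C; rewrite inE => /orP[/eqP->//|]; exact: tP.
Qed.

(** Unless some free ultrafilter has a small base, a small family with the
    strong finite intersection property can be extended by a set with a hull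
    outside a given ultrafilter. Indeed, split nat into blocks so long that
    hulls only reach the neighbouring blocks, and keep one block out of three.
    Disjoint unions of the remaining blocks have disjoint hulls, so at most one
    of two complementary ones is compatible with the family, which thus
    generates an ultrafilter on the set of blocks. *)
Lemma sfip_extend (T : Type) (b : T -> set nat) (V : set_system nat) (g : nat ->
    nat) :
  ~ (exists W, small_ultra W) -> small T -> sfip (range b) -> free_ultra V ->
  increasing g ->
  exists A, sfip (range b `|` [set A]) /\ V (~` hull g A).
Proof.
move=> noW Ts bf Vf gi; apply: contrapT => noA; apply: noW.
have VU := Vf.1.
have hullV A : (forall s, meets b s `&` A !=set0) -> V (hull g A).
  move=> /sfip_meets h; have [//|VnA] := in_ultra_setVsetC (hull g A) VU.
  by case: noA; exists A.
(* The n-th block is [k n, k n.+1), and h x is the index of the block of x. *)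
pose k n := iter n (fun x => (g x + x).+1) 0%N.
have ki : increasing k.
  by apply: homo_ltn => [y x z|n]; [exact: ltn_trans|rewrite /k /= ltnS
    leq_addl].
have kg n : (g (k n) < k n.+1)%N by rewrite /k /= ltnS leq_addr.
have [h hP] := increasing_blocks ki.
have {}hP n : (k (h n) <= n)%N /\ (n < k (h n).+1)%N by apply/andP/hP.
have h_near x y : (x <= g y)%N -> (h x <= (h y).+1)%N.
  move=> xy; rewrite -ltnS -(increasing_lt ki).
  apply: leq_ltn_trans (hP x).1 _; apply: leq_ltn_trans xy _;
    apply: leq_ltn_trans (kg _).
  by rewrite (increasing_le gi) ltnW // (hP y).2.
have h_ge M n : (k M <= n)%N -> (M <= h n)%N.
  by move=> Mn; rewrite -ltnS -(increasing_lt ki);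
    exact: leq_ltn_trans Mn (hP n).2.
have [U0 [U0U U0free] bU0] := sfip_free_ultra bf.
have [r U0r] : exists r, U0 [set n | h n %% 3 = r].
  have [u0|u0] := in_ultra_setVsetC [set n | h n %% 3 = 0%N] U0U;
    first by exists 0%N.
  have [u1|u1] := in_ultra_setVsetC [set n | h n %% 3 = 1%N] U0U;
    first by exists 1%N.
  exists 2%N; apply: filterS (filterI u0 u1) => n [/= n0 n1].
  by have := ltn_pmod (h n) (isT : 0 < 3)%N; lia.
have U0s s : U0 (meets b s).
  elim: s => [|[t|N] s ih] /=; first exact: filterT.
    by apply: filterI => //; apply: bU0; exists t.
  exact: filterI.
(* The candidate: the image under h of the filter generated by the family and
   the kept blocks. *)
pose c s := h @` (meets b s `&` [set n | h n %% 3 = r]).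
pose W : set_system nat := [set B | exists s, c s `<=` B].
have WP : ProperFilter W.
  split.
    move=> [s]; rewrite subset0 => s0.
    have [n ns] := filter_ex (filterI (U0s s) U0r).
    by have : c s (h n) by [exists n]; rewrite s0.
  split=> [|A B [s sA] [t tB]|A B AB [s sA]].
  - by exists [::].
  - exists (s ++ t); rewrite /c meets_cat => _ [n [[sn tn] rn] <-].
    by split; [apply: sA|apply: tB]; exists n.
  - by exists s; exact: subset_trans sA AB.
have cW s : W (c s) by exists s.
exists W; split.
  split; last first.
    move=> M; exists [:: inr (k M)] => _ [n [[/= Mn _] _] <-]; exact: h_ge.
  apply: ultra_dichotomy => B; apply: contrapT => /not_orP[WB WnB].
  have VA (C : set nat) : ~ W (~` C) ->
      V (hull g [set n | h n %% 3 = r /\ C (h n)]).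
    move=> WC; apply: hullV => s; apply: contrapT => s0; apply: WC; exists s.
    by move=> _ [n [sn rn] <-] Cn; apply: s0; exists n.
  have V1 := VA _ WnB.
  have V2 : V (hull g [set n | h n %% 3 = r /\ (~` B) (h n)]).
    by apply: VA; rewrite setCK.
  have [x [[a1 [[r1 B1] a1x xa1]] [a2 [[r2 B2] a2x xa2]]]] :=
    filter_ex (filterI V1 V2).
  apply: B2; suff <- : h a1 = h a2 by [].
  have := h_near _ _ a1x; have := h_near _ _ xa1.
  have := h_near _ _ a2x; have := h_near _ _ xa2; lia.
exists (seq (T + nat))%type, c; split=> //.
exact: small_seq_sum Ts small_nat.
Qed.

(** * Consequences of near coherence *)

Lemma wo_wf (a : woType) : well_founded (fun y x : a => ~~ wo_le x y).
Proof. by move=> x; elim/wo_ind: x => x ih; constructor. Qed.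

(** Unless some free ultrafilter has a small base, no free ultrafilter V is
    coherent with all the others: a transfinite construction of length d puts
    into an ultrafilter U, for each function g of a dominating family, a set A
    with a hull outside V. *)
Lemma noncoherent_ultra (e : dominating_number -> nat ->
    nat) (V : set_system nat) :
  ~ (exists W, small_ultra W) -> free_ultra V ->
  exists2 U, free_ultra U & forall a, exists2 A,
    U A & V (~` hull (hat (e a)) A).
Proof.
move=> noW Vf.
pose good (F : set (set nat)) a : set (set nat) :=
  [set A | sfip (F `|` [set A]) /\ V (~` hull (hat (e a)) A)].
(* Each stage picks a set in [good]. There always is one, so the default value
   set0 is never taken. *)
pose step a (rec : forall b, ~~ wo_le a b -> set nat) : set nat :=
  xget set0 (good [set B | exists b (h : ~~ wo_le a b), B = rec b h] a).
pose A := Fix (@wo_wf dominating_number) (fun=> set nat) step.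
pose below a := [set B | exists2 b, ~~ wo_le a b & B = A b].
have AE a : A a = xget set0 (good (below a) a).
  rewrite /A Fix_eq.
    rewrite /step; congr (xget _ (good _ _)); apply/seteqP; split=> B.
      by move=> [b [h ->]]; exists b.
    by move=> [b h ->]; exists b, h.
  move=> x f g fg; rewrite /step; congr (xget _ (good _ _)).
  by apply/seteqP; split=> B [b [h ->]]; exists b, h; rewrite fg.
(* A finite set of previous members lies below or at the largest of them. *)
have fin (P : set dominating_number) :
    (forall a, P a -> good (below a) a (A a)) ->
    sfip [set B | exists2 b, P b & B = A b].
  move=> gP s N sP.
  have [->|[a Pa sa]] : s = [::] \/ exists2 a, P a &
      forall B, B \in s -> (below a `|` [set A a]) B.
    elim: s sP => [|B s ih] sP; first by left.
    right; have [b Pb Bb] := sP B (mem_head _ _).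
    have [|s0|[a Pa sa]] := ih; first by move=> C Cs; apply: sP;
      rewrite inE Cs orbT.
      by exists b => // C; rewrite s0 inE => /eqP->; right; rewrite Bb.
    have [ab|ba] := boolP (wo_le a b); last first.
      exists a => // C; rewrite inE => /orP[/eqP->|/sa//].
      by left; exists b.
    exists b => // C; rewrite inE => /orP[/eqP->|/sa]; first by right;
      rewrite Bb.
    move=> [[c ca ->]|->].
      by left; exists c => //; exact: wo_lt_le_trans ca ab.
    have [ba|ba] := boolP (wo_le b a); last by left; exists a.
    by right; rewrite (wo_anti ab ba).
  - by exists N.
  - by have [/(_ s N sa)] := gP a Pa.
have goodA a : good (below a) a (A a).
  elim/wo_ind: a => a ih; rewrite AE; apply: xgetPex.
  pose b (x : wo_seg a) := A (sval x).
  have bE : range b = below a.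
    apply/seteqP; split=> [_ [[x xa] _ <-]|B [x xa ->]]; first by exists x.
    by exists (exist _ x xa).
  have [|C] := @sfip_extend _ b V (hat (e a)) noW (@small_seg a) _ Vf
    (@hat_increasing _).
    by rewrite bE; apply: fin.
  by rewrite bE; exists C.
have [|U Uf AU] := @sfip_free_ultra [set B | exists2 b, setT b & B = A b].
  by apply: fin.
exists U => // a; exists (A a); first by apply: AU; exists a.
by have [] := goodA a.
Qed.

(** NCF implies u < d. *)
Lemma NCF_small_ultra : NCF -> exists W, small_ultra W.
Proof.
move=> ncf; apply: contrapT => noW.
have [V Vf] := free_ultra_exists.
have [e _ edom] := min_cardP dominating_exists.
have [U Uf UV] := noncoherent_ultra e noW Vf.
have [k ki kUV] := ncf U V Uf.1 Vf.1 (free_ultra_nonprincipal Uf)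
  (free_ultra_nonprincipal Vf).
have [_ [a _ <-] kg] := edom (k \o succn).
have [A UA VA] := UV a.
have Vh : V (hull (hat (e a)) A).
  apply: (coherent_hull Uf Vf ki kUV _ UA).
  exact: le_star_trans kg (le_starW (le_hat _)).
have VV := Vf.1.
have Vn : V (hull (hat (e a)) A `&` ~` hull (hat (e a)) A) by exact: filterI.
by have [x []] := filter_ex Vn.
Qed.

(** A family that is not finitely dominating is bounded modulo some free
    ultrafilter. *)
Lemma not_finitely_dominating_bound (F : set (nat -> nat)) :
    ~ finitely_dominating F ->
  exists (U : set_system nat) (x : nat -> nat),
    [/\ free_ultra U, increasing x & forall f, F f ->
      U [set n | (f n < x n)%N]].
Proof.
move=> /existsNP[x0 nx]; pose x := hat x0.
have [|U Uf bU] := @sfip_free_ultra [set B | exists2 f,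
  F f & B = [set n | (f n < x n)%N]].
  move=> s N sF.
  suff [n Nn fx] : exists2 n, (N <= n)%N & forall B, B \in s -> B n by exists n.
  have [s0|[l [l0 lF sl]]] : s = [::] \/ exists l : seq (nat -> nat),
      [/\ (0 < size l)%N, forall i, (i < size l)%N -> F (nth id l i) &
      forall B, B \in s -> exists2 i, (i < size l)%N &
        B = [set n | (nth id l i n < x n)%N]].
    elim: s sF => [|B s ih] sF; first by left.
    right; have [f Ff Bf] := sF B (mem_head _ _).
    have [|s0|[l [l0 lF sl]]] := ih; first by move=> C Cs; apply: sF;
      rewrite inE Cs orbT.
      exists [:: f]; split=> // [[]//|C]; rewrite s0 inE => /eqP->.
      by exists 0%N.
    exists (f :: l); split=> // [[|i] //= il|C]; first exact: lF.
    rewrite inE => /orP[/eqP->|/sl[i il ->]]; first by exists 0%N.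
    by exists i.+1.
  - by exists N => // B; rewrite s0.
  - have : ~ le_star x0 (fun n => \max_(i < (size l).-1.+1) nth id l i n).
      move=> xl; apply: nx; exists (size l).-1,
        (fun i : 'I_(size l).-1.+1 => nth id l i).
      by split=> // i; apply: lF; rewrite -[X in (_ < X)%N](prednK l0).
    move=> /le_starP/forallNP/(_ N)/existsNP[n /not_implyP[Nn /negP]].
    rewrite -ltnNge => lx; exists n => // B /sl[i il ->] /=.
    apply: leq_trans (le_hat _ _); apply: leq_ltn_trans lx.
    have il' : (i < (size l).-1.+1)%N by rewrite prednK.
    exact: (@leq_bigmax 'I_(size l).-1.+1 (fun i => nth id l i n) (Ordinal
      il')).
exists U, x; split=> //; first exact: hat_increasing.
by move=> f Ff; apply: bU; exists f.
Qed.

(** If W is coherent, through the blocks of some k, with an ultrafilter modulo which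
    x bounds F, then each base c of W yields a family of functions indexed by c
    such that each nondecreasing member of F is bounded by one of them. *)
Lemma base_bound (U W : set_system nat) (F : set (nat -> nat)) (x : nat -> nat)
    (T : Type) (c : T -> set nat) :
  free_ultra U -> free_ultra W -> coherent U W -> increasing x ->
  (forall f, F f -> U [set n | (f n < x n)%N]) ->
  (forall t, W (c t)) -> (forall B, W B -> exists t, c t `<=` B) ->
  exists g : T -> nat -> nat, forall f, F f -> {homo f : m n / (m <= n)%N} ->
    exists t, forall n, (f n <= g t n)%N.
Proof.
move=> Uf Wf [k ki kUW] xi FU cW cbase; have UU := Uf.1.
have [h hP] := increasing_blocks ki.
have /choice[m mP] : forall tn : T * nat, exists m, (tn.2 <= k m)%N /\
    exists2 b, c tn.1 b & (k m <= b < k m.+1)%N.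
  move=> [t n] /=; have [b kb cb] := free_ultra_meet (k n) Wf (cW t).
  have /andP[b1 b2] : (k (h b) <= b < k (h b).+1)%N.
    by apply/hP/(leq_trans _ kb); rewrite (increasing_le ki).
  exists (h b); split; last by exists b; rewrite ?b1.
  apply: leq_trans (increasing_ge_id ki _).
  by rewrite -ltnS -(increasing_lt ki); exact: leq_ltn_trans kb b2.
exists (fun t n => x (k (m (t, n)).+1)) => f Ff fm.
pose I := [set i | exists2 a, (k i <= a < k i.+1)%N & (f a < x a)%N].
have /kUW/cbase[t ct] : U (\bigcup_(n in I) [set m | (k n <= m < k n.+1)%N]).
  apply: filterS (filterI (FU f Ff) (Uf.2 (k 0%N))) => a [fa ka].
  by exists (h a); [exists a => //|]; exact: hP.
exists t => n; have [/= nm [b /ct[i [a /andP[ia ai] fa] /andP[ib bi]]]] :=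
  mP (t, n).
move=> /andP[mb bm].
have mi : m (t, n) = i.
  have := leq_ltn_trans mb bi; have := leq_ltn_trans ib bm.
  by rewrite !(increasing_lt ki); lia.
rewrite mi in nm *.
apply: leq_trans (fm _ _ nm) _; apply: leq_trans (fm _ _ ia) _.
by apply: leq_trans (ltnW fa) _; rewrite (increasing_le xi) ltnW.
Qed.

Lemma NCF_dominating_le_cov_Dfin : NCF -> ord_le dominating_number cov_Dfin.
Proof.
move=> ncf; apply: contrapT => /not_dominating_le_small Cs.
have [W [Wf [T [c [Ts cW cbase]]]]] := NCF_small_ultra ncf.
have [C _ [CF Ccov]] : exists2 C : cov_Dfin -> set (nat -> nat), injective C &
    (forall A, range C A -> A `<=` unbounded_nondecreasing /\ ~
      finitely_dominating A) /\
    \bigcup_(A in range C) A = unbounded_nondecreasing.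
  apply: min_cardP; exists (range (fun f => [set f]) `&` [set A | A `<=`
    unbounded_nondecreasing]).
  split=> [_ [[f _ <-] fu]|].
    split=> // /(_ (fun n => (f n).+1))[n [g [gf /le_starP[N /(_ N (leqnn
      N))]]]].
    by rewrite ltnNge; apply/negP; rewrite negbK; apply/bigmax_leqP => i _;
      rewrite (gf i).
  apply/seteqP; split=> [f [A [_ Au] Af]|f fu]; first exact: Au.
  exists [set f] => //; split; first by exists f.
  by move=> _ ->.
have /choice[g gP] : forall i, exists g : T -> nat -> nat, forall f, C i f ->
    exists t, forall n, (f n <= g t n)%N.
  move=> i; have [Ciu /not_finitely_dominating_bound[U [x [Uf xi CU]]]] :
    C i `<=` unbounded_nondecreasing /\ ~ finitely_dominating (C i) by apply:
      CF; exists i.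
  have UW := ncf U W Uf.1 Wf.1 (free_ultra_nonprincipal Uf)
    (free_ultra_nonprincipal Wf).
  have [g gP] := base_bound Uf Wf UW xi CU cW cbase.
  by exists g => f Cf; apply: gP => //; exact: (Ciu _ Cf).1.
(* A pair of indices is coded as a sequence of length two. *)
have := @small_seq_sum _ _ Cs Ts.
move=> /(_ (fun s => if s is [:: inl i; inr t] then g i t else id)); apply=> y.
have yu : unbounded_nondecreasing (hat y).
  split=> [m n|b]; first by rewrite (increasing_le (@hat_increasing y)).
  by exists b.+1; exact: (increasing_ge_id (@hat_increasing y)).
have [_ [i _ <-] /gP[t yt]] : (\bigcup_(A in range C) A) (hat y) by rewrite
  Ccov.
exists (g i t); first by exists [:: inl i; inr t].
by apply: le_starW => n; exact: leq_trans (le_hat _ _) (yt n).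
Qed.

Theorem theorem1p10 :
  ord_le cov_Dfin cf_star_Sym /\
  (NCF -> ord_eq cf_star_Sym dominating_number).
Proof.
split=> [|ncf]; first exact: cov_Dfin_le_cf_star.
apply: ord_le_anti; first exact: cf_star_le_dominating.
apply: ord_le_trans cov_Dfin_le_cf_star; exact: NCF_dominating_le_cov_Dfin.
Qed.
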